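(* (a) Let $A_\infty>B$ and $h_0>h_2$ be the constants of the convective condition in problem (P1), and let $\xi_2$ be the corresponding coefficient of the solution of (P1). If $$\frac{(A_\infty-B)h_0}{1+\frac{h_0\sqrt{\pi\alpha_3}}{k_3}\operatorname{erf}\left(\xi_2\sqrt{\frac{\alpha_1}{\alpha_3}}\right)}>\frac{k_2(B-C)}{\sqrt{\alpha_2\pi}\operatorname{erf}\left(z_0\sqrt{\frac{\alpha_1}{\alpha_2}}\right)},$$ then the solution of problem (P3) with $$q_0=\frac{(A_\infty-B)h_0}{1+\frac{h_0\sqrt{\pi\alpha_3}}{k_3}\operatorname{erf}\left(\xi_2\sqrt{\frac{\alpha_1}{\alpha_3}}\right)}$$ coincides with the solution of problem (P1). (b) Let $q_0>q_2$ be the constant of the flux condition in problem (P3), let $\lambda_2$ be the corresponding coefficient of the solution of (P3), and let $A_\infty>B$. If $$\frac{q_0}{(A_\infty-B)-q_0\frac{\sqrt{\pi\alpha_3}}{k_3}\operatorname{erf}\left(\lambda_2\sqrt{\frac{\alpha_1}{\alpha_3}}\right)}>\frac{B-C}{A_\infty-B}\sqrt{\frac{k_2k_3c_2}{\pi\alpha_3c_3}}\;\frac{1}{\operatorname{erf}\left(z_0\sqrt{\frac{\alpha_1}{\alpha_2}}\right)}$$ (in particular the denominator on the left is nonzero), then the solution of problem (P1) with bulk temperature $A_\infty$ and $$h_0=\frac{q_0}{(A_\infty-B)-q_0\frac{\sqrt{\pi\alpha_3}}{k_3}\operatorname{erf}\left(\lambda_2\sqrt{\frac{\alpha_1}{\alpha_3}}\right)}$$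 coincides with the solution of problem (P3).
   Context: Data: positive constants $\rho$, $k_i,c_i$ ($i=1,2,3$), $\ell_1,\ell_2$; $\alpha_i=\frac{k_i}{\rho c_i}$, $\delta_i=\rho\ell_i$ ($i=1,2$); it is assumed that $\alpha_2>\alpha_3$. Real temperatures $B>C>D$. Common system (S): find $\Phi_3$ (on $0<x<y_2(t)$), $\Phi_2$ (on $y_2(t)<x<y_1(t)$), $\Phi_1$ (on $x>y_1(t)$) and free boundaries $y_1,y_2$ such that, for $t>0$: $\partial_t\Phi_i=\alpha_i\partial_{xx}\Phi_i$ in the respective region; $\Phi_3(y_2(t),t)=\Phi_2(y_2(t),t)=B$; $\Phi_2(y_1(t),t)=\Phi_1(y_1(t),t)=C$; $\Phi_1(x,0)=\Phi_1(+\infty,t)=D$ (as limits); $k_2\partial_x\Phi_2(y_2(t),t)-k_3\partial_x\Phi_3(y_2(t),t)=\delta_2\dot y_2(t)$; $k_1\partial_x\Phi_1(y_1(t),t)-k_2\partial_x\Phi_2(y_1(t),t)=\delta_1\dot y_1(t)$; $y_1(0)=y_2(0)=0$. (P1) is (S) with $k_3\partial_x\Phi_3(0,t)=\frac{h_0}{\sqrt t}(\Phi_3(0,t)-A_\infty)$, $t>0$, where $h_0>0$, $A_\infty>B$. (P3) is (S) with $k_3\partial_x\Phi_3(0,t)=-\frac{q_0}{\sqrt t}$, $t>0$, where $q_0>0$. ''The solution'' means the unique similarity-type solution, i.e. of the form $\Phi_i=A_i+B_i\operatorname{erf}\left(\frac{x}{2\sqrt{\alpha_it}}\right)$ with real constants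 $A_i,B_i$ and $y_i(t)=2\eta_i\sqrt{\alpha_1t}$ with $0<\eta_2<\eta_1$. Two solutions coincide if their free boundaries and all three temperatures are equal. Functions: $\operatorname{erf}^{-1}:(-1,1)\to\mathbb R$ is the inverse of $\operatorname{erf}$, $\operatorname{erfc}=1-\operatorname{erf}$, $\mathrm{Ste}_1=\frac{c_1(C-D)}{\ell_1}$, $\mathrm{Ste}_2=\frac{c_2(B-C)}{\ell_2}$, and $$\varphi(z)=z+\frac{\mathrm{Ste}_1}{\sqrt\pi}\frac{\exp(-z^2)}{\operatorname{erfc}(z)},\qquad H(z)=\operatorname{erf}\left(z\sqrt{\tfrac{\alpha_1}{\alpha_2}}\right)-\frac{\mathrm{Ste}_2}{\sqrt\pi}\frac{\ell_2}{\ell_1}\sqrt{\frac{k_2c_1}{k_1c_2}}\,\frac{\exp\left(-z^2\frac{\alpha_1}{\alpha_2}\right)}{\varphi(z)},$$ $$Q(z)=\frac{\ell_1}{\ell_2}\varphi(z)\exp\left(z^2\tfrac{\alpha_1}{\alpha_2}\right)\qquad(z\ge0),$$ $$T(z)=\frac{\mathrm{Ste}_2}{\sqrt\pi\,c_2}\frac{A_\infty-B}{B-C}\sqrt{\frac{k_3c_1c_3}{k_1}}\;\frac{\exp\left(-z^2\alpha_1\left(\frac1{\alpha_3}-\frac1{\alpha_2}\right)\right)}{\frac{k_3}{h_0\sqrt{\pi\alpha_3}}+\operatorname{erf}\left(z\sqrt{\frac{\alpha_1}{\alpha_3}}\right)}-z\exp\left(z^2\tfrac{\alpha_1}{\alpha_2}\right)\qquad(z\ge0),$$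 $$P(z)=\exp\left(z^2\tfrac{\alpha_1}{\alpha_2}\right)\left[-z+\frac{q_0}{\ell_2}\sqrt{\frac{c_1}{\rho k_1}}\exp\left(-z^2\tfrac{\alpha_1}{\alpha_3}\right)\right]\qquad(z\ge0).$$ $z_0>0$ is the unique zero of the increasing function $H$; $h_2=\frac{B-C}{A_\infty-B}\sqrt{\frac{k_2k_3c_2}{\pi c_3\alpha_3}}\frac{1}{\operatorname{erf}(z_0\sqrt{\alpha_1/\alpha_2})}$ and $q_2=\frac{k_2(B-C)}{\sqrt{\alpha_2\pi}\operatorname{erf}(z_0\sqrt{\alpha_1/\alpha_2})}$. Write $g(z)=\sqrt{\frac{\alpha_2}{\alpha_1}}\operatorname{erf}^{-1}(H(z))$ for $z\ge z_0$. Solution of (P1), existing and unique for $h_0>h_2$: free boundaries $w_i(t)=2\xi_i\sqrt{\alpha_1t}$, where $\xi_1$ is the unique solution in $(z_0,\infty)$ of $Q(z)=T(g(z))$ and $\xi_2=g(\xi_1)$; temperatures $v_3=\dfrac{\frac{Bk_3}{h_0\sqrt{\pi\alpha_3}}+A_\infty\operatorname{erf}(\xi_2\sqrt{\alpha_1/\alpha_3})-(A_\infty-B)\operatorname{erf}\left(\frac{x}{2\sqrt{\alpha_3t}}\right)}{\frac{k_3}{h_0\sqrt{\pi\alpha_3}}+\operatorname{erf}(\xi_2\sqrt{\alpha_1/\alpha_3})}$, $v_2=C+(B-C)\dfrac{\operatorname{erf}(\xi_1\sqrt{\alpha_1/\alpha_2})-\operatorname{erf}\left(\frac{x}{2\sqrt{\alpha_2t}}\right)}{\operatorname{erf}(\xi_1\sqrt{\alpha_1/\alpha_2})-\operatorname{erf}(\xi_2\sqrt{\alpha_1/\alpha_2})}$,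 $v_1=D+(C-D)\dfrac{\operatorname{erfc}\left(\frac{x}{2\sqrt{\alpha_1t}}\right)}{\operatorname{erfc}(\xi_1)}$. Solution of (P3), existing and unique for $q_0>q_2$: free boundaries $s_i(t)=2\lambda_i\sqrt{\alpha_1t}$, where $\lambda_1$ is the unique solution in $(z_0,\infty)$ of $Q(z)=P(g(z))$ and $\lambda_2=g(\lambda_1)$; temperatures $\theta_3=B+\frac{q_0\sqrt{\pi\alpha_3}}{k_3}\left(\operatorname{erf}(\lambda_2\sqrt{\alpha_1/\alpha_3})-\operatorname{erf}\left(\frac{x}{2\sqrt{\alpha_3t}}\right)\right)$, and $\theta_2,\theta_1$ given by the formulas for $v_2,v_1$ with $\xi_i$ replaced by $\lambda_i$. *)

(* Defs.v *)
From Stdlib Require Import Reals.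
From Coquelicot Require Import Coquelicot.
Open Scope R_scope.

Definition erf (z : R) : R := 2 / sqrt PI * RInt (fun u => exp (- u ^ 2)) 0 z.
Definition erfc (z : R) : R := 1 - erf z.

(** [TB], [TC], [TD] are the temperatures [B > C > D]; the letters themselves
    are avoided because Coquelicot's [C] is the type of complex numbers. *)
Record data := Data {
  rho : R;
  k1 : R; k2 : R; k3 : R;
  c1 : R; c2 : R; c3 : R;
  ell1 : R; ell2 : R;
  TB : R; TC : R; TD : R }.

Definition alpha1 (d : data) : R := k1 d / (rho d * c1 d).
Definition alpha2 (d : data) : R := k2 d / (rho d * c2 d).
Definition alpha3 (d : data) : R := k3 d / (rho d * c3 d).
Definition delta1 (d : data) : R := rho d * ell1 d.
Definition delta2 (d : data) : R := rho d * ell2 d.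

Record admissible (d : data) : Prop := Admissible {
  rho_gt0 : 0 < rho d;
  k1_gt0 : 0 < k1 d; k2_gt0 : 0 < k2 d; k3_gt0 : 0 < k3 d;
  c1_gt0 : 0 < c1 d; c2_gt0 : 0 < c2 d; c3_gt0 : 0 < c3 d;
  ell1_gt0 : 0 < ell1 d; ell2_gt0 : 0 < ell2 d;
  alpha3_lt_alpha2 : alpha3 d < alpha2 d;
  TC_lt_TB : TC d < TB d;
  TD_lt_TC : TD d < TC d }.

Definition Ste1 (d : data) : R := c1 d * (TC d - TD d) / ell1 d.
Definition Ste2 (d : data) : R := c2 d * (TB d - TC d) / ell2 d.

Definition phi (d : data) (z : R) : R :=
  z + Ste1 d / sqrt PI * (exp (- z ^ 2) / erfc z).

Definition Hfun (d : data) (z : R) : R :=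
  erf (z * sqrt (alpha1 d / alpha2 d))
  - Ste2 d / sqrt PI * (ell2 d / ell1 d)
    * sqrt (k2 d * c1 d / (k1 d * c2 d))
    * (exp (- z ^ 2 * (alpha1 d / alpha2 d)) / phi d z).

(** In [h2] and [q2] the argument [z0] stands for the positive zero of [Hfun d]. *)
Definition h2 (d : data) (Ainf z0 : R) : R :=
  (TB d - TC d) / (Ainf - TB d)
  * sqrt (k2 d * k3 d * c2 d / (PI * c3 d * alpha3 d))
  * (1 / erf (z0 * sqrt (alpha1 d / alpha2 d))).

Definition q2 (d : data) (z0 : R) : R :=
  k2 d * (TB d - TC d)
  / (sqrt (alpha2 d * PI) * erf (z0 * sqrt (alpha1 d / alpha2 d))).

(** A candidate solution.  [Phi i x t] is meaningful only for [x] in the closed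
    [i]-th region at time [t]; its values elsewhere are junk, which is why the
    derivatives on the boundaries of the regions are one-sided below. *)
Record candidate := Candidate {
  Phi1 : R -> R -> R; Phi2 : R -> R -> R; Phi3 : R -> R -> R;
  y1 : R -> R; y2 : R -> R }.

Definition is_right_derive (f : R -> R) (x l : R) : Prop :=
  filterlim (fun h => (f (x + h) - f x) / h) (at_right 0) (locally l).
Definition is_left_derive (f : R -> R) (x l : R) : Prop :=
  filterlim (fun h => (f (x + h) - f x) / h) (at_left 0) (locally l).

Definition heat_at (a : R) (F : R -> R -> R) (x t : R) : Prop :=
  ex_derive (fun s => F x s) t /\
  ex_derive (fun z => F z t) x /\
  ex_derive_n (fun z => F z t) 2 x /\
  Derive (fun s => F x s) t = a * Derive_n (fun z => F z t) 2 x.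

(** The Stefan conditions [kp * dFp/dx - km * dFm/dx = dl * y'] at [x = y t],
    where [Fm] lives to the left and [Fp] to the right of the front [y]. *)
Definition stefan_at (kp km dl : R) (Fp Fm : R -> R -> R) (y : R -> R) (t : R)
    : Prop :=
  exists p m v : R,
    is_right_derive (fun x => Fp x t) (y t) p /\
    is_left_derive (fun x => Fm x t) (y t) m /\
    is_derive y t v /\
    kp * p - km * m = dl * v.

Record system_S (d : data) (s : candidate) : Prop := SystemS {
  S_order : forall t, 0 < t -> 0 < y2 s t < y1 s t;
  S_heat3 : forall x t, 0 < t -> 0 < x < y2 s t ->
    heat_at (alpha3 d) (Phi3 s) x t;
  S_heat2 : forall x t, 0 < t -> y2 s t < x < y1 s t ->
    heat_at (alpha2 d) (Phi2 s) x t;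
  S_heat1 : forall x t, 0 < t -> y1 s t < x ->
    heat_at (alpha1 d) (Phi1 s) x t;
  S_front2 : forall t, 0 < t ->
    Phi3 s (y2 s t) t = TB d /\ Phi2 s (y2 s t) t = TB d;
  S_front1 : forall t, 0 < t ->
    Phi2 s (y1 s t) t = TC d /\ Phi1 s (y1 s t) t = TC d;
  S_initial : forall x, 0 < x ->
    filterlim (fun t => Phi1 s x t) (at_right 0) (locally (TD d));
  S_infinity : forall t, 0 < t ->
    is_lim (fun x => Phi1 s x t) p_infty (TD d);
  S_stefan2 : forall t, 0 < t ->
    stefan_at (k2 d) (k3 d) (delta2 d) (Phi2 s) (Phi3 s) (y2 s) t;
  S_stefan1 : forall t, 0 < t ->
    stefan_at (k1 d) (k2 d) (delta1 d) (Phi1 s) (Phi2 s) (y1 s) t;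
  S_start : y1 s 0 = 0 /\ y2 s 0 = 0 }.

Definition problem_P1 (d : data) (h0 Ainf : R) (s : candidate) : Prop :=
  0 < h0 /\ TB d < Ainf /\ system_S d s /\
  forall t, 0 < t -> exists p : R,
    is_right_derive (fun x => Phi3 s x t) 0 p /\
    k3 d * p = h0 / sqrt t * (Phi3 s 0 t - Ainf).

Definition problem_P3 (d : data) (q0 : R) (s : candidate) : Prop :=
  0 < q0 /\ system_S d s /\
  forall t, 0 < t -> exists p : R,
    is_right_derive (fun x => Phi3 s x t) 0 p /\
    k3 d * p = - (q0 / sqrt t).

Definition similarity_profile (a A B x t : R) : R :=
  A + B * erf (x / (2 * sqrt (a * t))).

Definition similarity_type (d : data) (s : candidate) (eta1 eta2 : R) : Prop :=
  0 < eta2 < eta1 /\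
  (forall t, 0 <= t ->
     y1 s t = 2 * eta1 * sqrt (alpha1 d * t) /\
     y2 s t = 2 * eta2 * sqrt (alpha1 d * t)) /\
  exists A1 B1 A2 B2 A3 B3 : R, forall x t, 0 < t ->
    (0 <= x <= y2 s t ->
       Phi3 s x t = similarity_profile (alpha3 d) A3 B3 x t) /\
    (y2 s t <= x <= y1 s t ->
       Phi2 s x t = similarity_profile (alpha2 d) A2 B2 x t) /\
    (y1 s t <= x ->
       Phi1 s x t = similarity_profile (alpha1 d) A1 B1 x t).

Definition coincide (s s' : candidate) : Prop :=
  (forall t, 0 <= t -> y1 s t = y1 s' t /\ y2 s t = y2 s' t) /\
  (forall x t, 0 < t ->
     (0 <= x <= y2 s t -> Phi3 s x t = Phi3 s' x t) /\
     (y2 s t <= x <= y1 s t -> Phi2 s x t = Phi2 s' x t) /\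
     (y1 s t <= x -> Phi1 s x t = Phi1 s' x t)).

Definition similarity_solution (d : data) (pb : candidate -> Prop)
    (s : candidate) (eta1 eta2 : R) : Prop :=
  pb s /\ similarity_type d s eta1 eta2.

Definition the_similarity_solution (d : data) (pb : candidate -> Prop)
    (s : candidate) : Prop :=
  (exists eta1 eta2 : R, similarity_solution d pb s eta1 eta2) /\
  (forall (s' : candidate) (eta1' eta2' : R),
     similarity_solution d pb s' eta1' eta2' -> coincide s' s).

Definition equivalent_flux (d : data) (h0 Ainf xi2 : R) : R :=
  (Ainf - TB d) * h0
  / (1 + h0 * sqrt (PI * alpha3 d) / k3 d
         * erf (xi2 * sqrt (alpha1 d / alpha3 d))).

Definition equivalent_transfer_denominator (d : data) (q0 Ainf lambda2 : R) : R :=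
  (Ainf - TB d)
  - q0 * (sqrt (PI * alpha3 d) / k3 d)
    * erf (lambda2 * sqrt (alpha1 d / alpha3 d)).

Definition equivalent_transfer (d : data) (q0 Ainf lambda2 : R) : R :=
  q0 / equivalent_transfer_denominator d q0 Ainf lambda2.

(* Main.v *)
Require Import Defs.
From Stdlib Require Import Reals Lra.
From Coquelicot Require Import Coquelicot.
Open Scope R_scope.

(** The given solution itself satisfies the other boundary condition at [x = 0],
    so the point is uniqueness among similarity solutions.  The conditions on the
    fronts eliminate all temperatures and leave two equations
    [N e1 = F] and [G e2 = F] with
    [F = K / (erf (r2 * e1) - erf (r2 * e2))], where [N] is increasing (by
    monotonicity of the Mills ratio) and [G] is decreasing (this uses
    [alpha3 < alpha2]).  If [e1 < e1'], then [F < F'], so [e2' < e2] and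
    [erf (r2 * e1) - erf (r2 * e2)] grows, which makes [F] shrink: contradiction.
    The convective problem is the flux problem whose flux is a nonincreasing
    function of [e2], for which the argument is unchanged. *)

(** * The error function and the Mills ratio *)

Lemma sqrt_PI_gt0 : 0 < sqrt PI.
Proof. apply sqrt_lt_R0, PI_RGT_0. Qed.

Lemma is_derive_erf (z : R) : is_derive erf z (2 / sqrt PI * exp (- z ^ 2)).
Proof.
unfold erf.
assert (Hc : forall u, continuous (fun u => exp (- u ^ 2)) u).
{ intros u. apply (@ex_derive_continuous R_AbsRing R_NormedModule). auto_derive; trivial. }
apply (is_derive_scal (fun z => RInt (fun u => exp (- u ^ 2)) 0 z)).
apply (is_derive_RInt (fun u => exp (- u ^ 2)) _ 0); [|apply Hc].
apply filter_forall; intros x.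
apply (@RInt_correct R_CompleteNormedModule), (@ex_RInt_continuous R_CompleteNormedModule).
intros u _; apply Hc.
Qed.

Lemma erf_0 : erf 0 = 0.
Proof. unfold erf. rewrite RInt_point. unfold zero; simpl; ring. Qed.

Lemma strict_mono_of_derive (f df : R -> R) (x y : R) :
  (forall z, is_derive f z (df z)) -> (forall z, x < z < y -> 0 < df z) ->
  x < y -> f x < f y.
Proof.
intros Hd Hp Hxy.
destruct (MVT_cor2 f df x y Hxy) as [c [Hc Hc']].
{ intros c _. now apply is_derive_Reals. }
specialize (Hp c Hc'). nra.
Qed.

Lemma erf_increasing (x y : R) : x < y -> erf x < erf y.
Proof.
apply strict_mono_of_derive with (1 := is_derive_erf).
intros z _. apply Rmult_lt_0_compat; [|apply exp_pos].
apply Rdiv_lt_0_compat; [lra|apply sqrt_PI_gt0].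
Qed.

Lemma erf_gt0 (z : R) : 0 < z -> 0 < erf z.
Proof. intros H. rewrite <- erf_0. now apply erf_increasing. Qed.

Lemma erf_lt_lim (L z : R) : is_lim erf p_infty L -> erf z < L.
Proof.
intros HL.
(* Passing to the limit keeps only weak inequalities; the detour through [z + 1] saves
   strictness. *)
apply Rlt_le_trans with (erf (z + 1)); [apply erf_increasing; lra|].
apply (is_lim_le_loc (fun _ => erf (z + 1)) erf p_infty (erf (z + 1)) L);
  [|apply is_lim_const | exact HL].
exists (z + 1). intros x Hx. apply Rlt_le, erf_increasing, Hx.
Qed.

(* For [x >= z] the function [exp (- x ^ 2) / sqrt PI + z * erf x] decreases;
   compare its value at [z] with its limit at infinity. *)
Lemma mills_bound (L z : R) :
  is_lim erf p_infty L -> 0 < z -> z * (L - erf z) <= exp (- z ^ 2) / sqrt PI.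
Proof.
intros HL Hz.
pose proof sqrt_PI_gt0 as HP.
assert (H : L <= erf z + exp (- z ^ 2) / sqrt PI / z).
{ apply (is_lim_le_loc erf (fun _ => erf z + exp (- z ^ 2) / sqrt PI / z)
           p_infty L (erf z + exp (- z ^ 2) / sqrt PI / z));
    [|exact HL | apply is_lim_const].
  exists z. intros x Hx.
  (* The sign is flipped to fit [strict_mono_of_derive]: the negated function has derivative
     [(x - z) * (2 / sqrt PI * exp (- x ^ 2))], positive beyond [z]. Dropping the positive term
     [exp (- x ^ 2) / sqrt PI] then bounds [z * erf x] from above. *)
  assert (Hd : - (exp (- z ^ 2) / sqrt PI + z * erf z)
               < - (exp (- x ^ 2) / sqrt PI + z * erf x)).
  { apply (strict_mono_of_derive
             (fun x => - (exp (- x ^ 2) / sqrt PI + z * erf x))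
             (fun x => (x - z) * (2 / sqrt PI * exp (- x ^ 2)))); [| |exact Hx].
    - intros u.
      pose proof (is_derive_erf u) as Hu.
      auto_derive; [now eexists; exact Hu|].
      replace (Derive (fun x => erf x) u) with (2 / sqrt PI * exp (- u ^ 2))
        by (symmetry; exact (is_derive_unique _ _ _ Hu)).
      simpl. field. lra.
    - intros u Hu. apply Rmult_lt_0_compat; [lra|].
      apply Rmult_lt_0_compat; [|apply exp_pos].
      apply Rdiv_lt_0_compat; lra. }
  assert (He : 0 < exp (- x ^ 2) / sqrt PI)
    by (apply Rdiv_lt_0_compat; [apply exp_pos|exact HP]).
  apply Rmult_le_reg_l with z; [exact Hz|].
  replace (z * (erf z + exp (- z ^ 2) / sqrt PI / z))
    with (z * erf z + exp (- z ^ 2) / sqrt PI) by (field; lra).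
  lra. }
apply Rmult_le_compat_l with (r := z) in H; [|lra].
replace (z * (erf z + exp (- z ^ 2) / sqrt PI / z))
  with (z * erf z + exp (- z ^ 2) / sqrt PI) in H by (field; lra).
lra.
Qed.

(** The derivative has the sign of [exp (- u ^ 2) / sqrt PI - u * (L - erf u)], which [mills_bound]
    shows to be nonnegative. *)
Lemma mills_ratio_monotone (L x y : R) :
  is_lim erf p_infty L -> 0 < x -> x < y ->
  exp (- x ^ 2) / (L - erf x) <= exp (- y ^ 2) / (L - erf y).
Proof.
intros HL Hx Hxy.
destruct (MVT_cor2 (fun u => exp (- u ^ 2) / (L - erf u))
  (fun u => 2 * exp (- u ^ 2) * (exp (- u ^ 2) / sqrt PI - u * (L - erf u))
            / (L - erf u) ^ 2) x y Hxy) as [c [Hc Hc']].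
{ intros c Hc. apply is_derive_Reals.
  pose proof (erf_lt_lim L c HL) as HLc.
  pose proof (is_derive_erf c) as Hu.
  pose proof sqrt_PI_gt0 as HP.
  auto_derive; [split; [eexists; exact Hu|split; [lra|exact I]]|].
  replace (Derive (fun x => erf x) c) with (2 / sqrt PI * exp (- c ^ 2))
    by (symmetry; exact (is_derive_unique _ _ _ Hu)).
  simpl. field. lra. }
pose proof (erf_lt_lim L c HL) as HLc.
pose proof (mills_bound L c HL ltac:(lra)) as Hm.
assert (0 <= 2 * exp (- c ^ 2) * (exp (- c ^ 2) / sqrt PI - c * (L - erf c))
            / (L - erf c) ^ 2).
{ apply Rle_mult_inv_pos; [|apply pow_lt; lra].
  pose proof (exp_pos (- c ^ 2)). apply Rmult_le_pos; lra. }
nra.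
Qed.

(** * Uniqueness of the pair of front coefficients *)

Lemma exp_sqr_increasing (r x y : R) :
  0 < r -> 0 < x < y -> exp ((r * x) ^ 2) < exp ((r * y) ^ 2).
Proof.
intros Hr Hxy. apply exp_increasing. rewrite !Rpow_mult_distr.
apply Rmult_lt_compat_l; [apply pow_lt; exact Hr|nra].
Qed.

(** [a z + b exp (- z ^ 2) / (L - erf z)] is the function [phi] of the paper up
    to a factor, and [q] is the flux entering at [x = 0] as a function of the
    coefficient of the second front. *)
Lemma fronts_unique (L a b K dl r2 r3 : R) (q : R -> R) (e1 e2 f1 f2 : R) :
  is_lim erf p_infty L -> 0 < a -> 0 < b -> 0 < K -> 0 < dl ->
  0 < r2 < r3 ->
  (forall x y, 0 < x -> x <= y -> 0 < q y <= q x) ->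
  0 < e2 < e1 -> 0 < f2 < f1 ->
  a * e1 + b * (exp (- e1 ^ 2) / (L - erf e1))
    = K / (erf (r2 * e1) - erf (r2 * e2)) * exp (- (r2 * e1) ^ 2) ->
  q e2 * exp (- (r3 * e2) ^ 2) - dl * e2
    = K / (erf (r2 * e1) - erf (r2 * e2)) * exp (- (r2 * e2) ^ 2) ->
  a * f1 + b * (exp (- f1 ^ 2) / (L - erf f1))
    = K / (erf (r2 * f1) - erf (r2 * f2)) * exp (- (r2 * f1) ^ 2) ->
  q f2 * exp (- (r3 * f2) ^ 2) - dl * f2
    = K / (erf (r2 * f1) - erf (r2 * f2)) * exp (- (r2 * f2) ^ 2) ->
  e1 = f1 /\ e2 = f2.
Proof.
intros HL Ha Hb HK Hdl Hr Hq He Hf E1 E2 F1 F2.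
(* Multiplying each equation by [exp ((r2 * z) ^ 2)], with [z] its own front coefficient, leaves the
   same right-hand side [K / De] in both; [N] and [G] are the resulting left-hand sides. *)
pose (De := fun x y => erf (r2 * x) - erf (r2 * y)).
pose (N := fun z => exp ((r2 * z) ^ 2) * (a * z + b * (exp (- z ^ 2) / (L - erf z)))).
pose (G := fun z => q z * exp (- (r3 ^ 2 - r2 ^ 2) * z ^ 2)
                    - dl * z * exp ((r2 * z) ^ 2)).
assert (Hcancel : forall w X Y, X = Y * exp (- w) -> exp w * X = Y).
{ intros w X Y ->. rewrite exp_Ropp. field. apply Rgt_not_eq, exp_pos. }
assert (HG : forall z, exp ((r2 * z) ^ 2) * (q z * exp (- (r3 * z) ^ 2) - dl * z) = G z).
{ intros z. unfold G.
  replace (- (r3 ^ 2 - r2 ^ 2) * z ^ 2) with ((r2 * z) ^ 2 + - (r3 * z) ^ 2) by ring.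
  rewrite exp_plus. ring. }
apply Hcancel in E1, E2, F1, F2.
fold (N e1) in E1. fold (N f1) in F1. rewrite HG in E2, F2.
fold (De e1 e2) in E1, E2. fold (De f1 f2) in F1, F2.
assert (HDe : forall x y, 0 < y < x -> 0 < De x y).
{ intros x y Hxy.
  assert (erf (r2 * y) < erf (r2 * x)) by (apply erf_increasing; nra).
  unfold De; lra. }
assert (HN : forall x y, 0 < x < y -> N x < N y).
{ intros x y Hxy. unfold N.
  assert (HE : 0 < exp (- x ^ 2) / (L - erf x)).
  { apply Rdiv_lt_0_compat; [apply exp_pos|].
    pose proof (erf_lt_lim L x HL); lra. }
  pose proof (mills_ratio_monotone L x y HL ltac:(lra) ltac:(lra)).
  apply Rmult_gt_0_lt_compat; [nra | apply exp_pos | apply exp_sqr_increasing; lra |].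
  nra. }
(* Since [r2 < r3], the exponential multiplying [q] decreases; [q] is positive and nonincreasing,
   and the subtracted term increases. *)
assert (HGd : forall x y, 0 < x < y -> G y < G x).
{ intros x y Hxy. unfold G.
  destruct (Hq x y) as [Hq1 Hq2]; [lra|lra|].
  assert (Hex : exp (- (r3 ^ 2 - r2 ^ 2) * y ^ 2) < exp (- (r3 ^ 2 - r2 ^ 2) * x ^ 2)).
  { apply exp_increasing.
    assert (0 < r3 ^ 2 - r2 ^ 2) by nra. assert (x ^ 2 < y ^ 2) by nra. nra. }
  pose proof (exp_pos (- (r3 ^ 2 - r2 ^ 2) * y ^ 2)).
  assert (Hlt : dl * x * exp ((r2 * x) ^ 2) < dl * y * exp ((r2 * y) ^ 2)).
  { apply Rmult_gt_0_lt_compat; [apply exp_pos | nra | nra |].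
    apply exp_sqr_increasing; lra. }
  nra. }
(* Stated for arbitrary pairs so that it excludes both [e1 < f1] and [f1 < e1]. *)
assert (Hle : forall x1 x2 w1 w2, 0 < x2 < x1 -> 0 < w2 < w1 ->
  N x1 = K / De x1 x2 -> G x2 = K / De x1 x2 ->
  N w1 = K / De w1 w2 -> G w2 = K / De w1 w2 -> ~ x1 < w1).
{ intros x1 x2 w1 w2 Hx Hw N1 G1 N2 G2 Hlt.
  assert (HF : K / De x1 x2 < K / De w1 w2) by (rewrite <- N1, <- N2; apply HN; lra).
  assert (HD : De w1 w2 < De x1 x2).
  { apply Rnot_le_lt. intros H. apply (Rlt_not_le _ _ HF).
    apply Rmult_le_compat_l; [lra|].
    apply Rinv_le_contravar; [now apply HDe|exact H]. }
  assert (Hxw : w2 < x2).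
  { destruct (Rtotal_order x2 w2) as [H|[H|H]]; [|subst w2; lra|exact H].
    pose proof (HGd x2 w2 ltac:(lra)). lra. }
  assert (erf (r2 * x1) < erf (r2 * w1)) by (apply erf_increasing; nra).
  assert (erf (r2 * w2) < erf (r2 * x2)) by (apply erf_increasing; nra).
  unfold De in HD. lra. }
assert (H1 : e1 = f1).
{ destruct (Rtotal_order e1 f1) as [H|[H|H]]; [|exact H|].
  - now apply (Hle e1 e2 f1 f2) in H.
  - now apply (Hle f1 f2 e1 e2) in H. }
split; [exact H1|].
(* With equal first coefficients the common value [N e1 = N f1] is also that of [G] at both second
   coefficients, and [G] is injective on positive numbers. *)
assert (HGG : G e2 = G f2) by (rewrite E2, F2, <- E1, <- F1, H1; reflexivity).
destruct (Rtotal_order e2 f2) as [H|[H|H]]; [|exact H|].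
- pose proof (HGd e2 f2 ltac:(lra)). lra.
- pose proof (HGd f2 e2 ltac:(lra)). lra.
Qed.

(** * One-sided derivatives, profiles and fronts *)

Lemma is_derive_right (f : R -> R) (x l : R) :
  is_derive f x l -> is_right_derive f x l.
Proof.
intros Hd. apply is_derive_Reals in Hd.
intros P [eps HP]. destruct (Hd eps (cond_pos eps)) as [del Hdel].
exists del. intros h Hh Hpos. apply HP. apply Hdel; [lra|].
replace h with (h - 0) by ring. exact Hh.
Qed.

Lemma is_derive_left (f : R -> R) (x l : R) :
  is_derive f x l -> is_left_derive f x l.
Proof.
intros Hd. apply is_derive_Reals in Hd.
intros P [eps HP]. destruct (Hd eps (cond_pos eps)) as [del Hdel].
exists del. intros h Hh Hpos. apply HP. apply Hdel; [lra|].
replace h with (h - 0) by ring. exact Hh.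
Qed.

(** A candidate agrees with a smooth profile only on the closed region of its phase. Agreement on a
    segment to the right of [x] already makes the difference quotients equal for small positive
    increments, and limits are unique. *)
Lemma right_derive_unique (f g : R -> R) (x y l p : R) :
  x < y -> (forall z, x <= z <= y -> f z = g z) ->
  is_derive g x l -> is_right_derive f x p -> p = l.
Proof.
intros Hxy Hfg Hg Hf. apply is_derive_right in Hg.
apply (filterlim_locally_unique (F := at_right 0) (fun h => (f (x + h) - f x) / h));
  [exact Hf|].
apply filterlim_ext_loc with (2 := Hg).
assert (Hyx : 0 < y - x) by lra.
exists (mkposreal _ Hyx). intros h Hh Hpos.
apply Rabs_lt_between in Hh. unfold minus, plus, opp in Hh; simpl in Hh.
rewrite !Hfg by lra. reflexivity.
Qed.

Lemma left_derive_unique (f g : R -> R) (x y l p : R) :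
  y < x -> (forall z, y <= z <= x -> f z = g z) ->
  is_derive g x l -> is_left_derive f x p -> p = l.
Proof.
intros Hxy Hfg Hg Hf. apply is_derive_left in Hg.
apply (filterlim_locally_unique (F := at_left 0) (fun h => (f (x + h) - f x) / h));
  [exact Hf|].
apply filterlim_ext_loc with (2 := Hg).
assert (Hyx : 0 < x - y) by lra.
exists (mkposreal _ Hyx). intros h Hh Hpos.
apply Rabs_lt_between in Hh. unfold minus, plus, opp in Hh; simpl in Hh.
rewrite !Hfg by lra. reflexivity.
Qed.

(** Time [1] suffices: for similarity profiles, the Stefan conditions and the conditions at [x = 0]
    at other times differ only by a common power of [t]. *)
Lemma is_derive_similarity_profile (a A B x : R) :
  0 < a ->
  is_derive (fun x => similarity_profile a A B x 1) x
    (B / sqrt (PI * a) * exp (- (x / (2 * sqrt a)) ^ 2)).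
Proof.
intros Ha. unfold similarity_profile. rewrite Rmult_1_r.
pose proof (is_derive_erf (x / (2 * sqrt a))) as Hu.
pose proof sqrt_PI_gt0. pose proof (sqrt_lt_R0 a Ha).
auto_derive; [now eexists; exact Hu|].
replace (Derive _ _) with (2 / sqrt PI * exp (- (x / (2 * sqrt a)) ^ 2))
  by (symmetry; exact (is_derive_unique _ _ _ Hu)).
rewrite sqrt_mult_alt by (pose proof PI_RGT_0; lra).
unfold Rdiv. field. lra.
Qed.

Lemma is_derive_front (y : R -> R) (a e v : R) :
  0 < a -> (forall t, 0 <= t -> y t = 2 * e * sqrt (a * t)) ->
  is_derive y 1 v -> v = e * sqrt a.
Proof.
intros Ha Hy Hv.
assert (Hs := sqrt_lt_R0 a Ha).
rewrite <- (is_derive_unique _ _ _ Hv). apply is_derive_unique.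
apply is_derive_ext_loc with (fun t => 2 * e * sqrt (a * t)).
(* Radius [1] around time [1] stays among positive times, where the formula for the front is
   available. *)
- exists (mkposreal 1 Rlt_0_1). intros t Ht.
  apply Rabs_lt_between in Ht. unfold minus, plus, opp in Ht; simpl in Ht.
  symmetry. apply Hy. lra.
- auto_derive; [lra|]. rewrite Rmult_1_r.
  rewrite <- (sqrt_sqrt a) at 1 by lra. field. lra.
Qed.

Lemma alpha_gt0 (d : data) :
  admissible d -> 0 < alpha1 d /\ 0 < alpha2 d /\ 0 < alpha3 d.
Proof.
intros []. unfold alpha1, alpha2, alpha3.
repeat split; (apply Rdiv_lt_0_compat; [|apply Rmult_lt_0_compat]); assumption.
Qed.

(** The factor [sqrt (a / b)] turns a front coefficient into the argument of [erf] on that front,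
    seen from a phase of diffusivity [b]. For phases 2 and 3 it becomes [ratio2] and [ratio3]. *)
Lemma front_argument (a b e : R) :
  0 < a -> 0 < b -> 2 * e * sqrt (a * 1) / (2 * sqrt b) = sqrt (a / b) * e.
Proof.
intros Ha Hb. rewrite Rmult_1_r, sqrt_div_alt by exact Hb.
pose proof (sqrt_lt_R0 b Hb). field. lra.
Qed.

Lemma is_derive_profile_at_front (a b A B e : R) :
  0 < a -> 0 < b ->
  is_derive (fun x => similarity_profile b A B x 1) (2 * e * sqrt (a * 1))
    (B / sqrt (PI * b) * exp (- (sqrt (a / b) * e) ^ 2)).
Proof.
intros Ha Hb. rewrite <- front_argument by assumption.
now apply is_derive_similarity_profile.
Qed.

(** * Extracting the coefficients of a similarity solution *)

Definition ratio2 (d : data) : R := sqrt (alpha1 d / alpha2 d).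
Definition ratio3 (d : data) : R := sqrt (alpha1 d / alpha3 d).

(** [L] stands for the limit of [erf]: its existence follows from the condition
    at infinity, and its value [1] is never needed. *)
Record similarity_coefficients (d : data) (s : candidate)
    (e1 e2 L A1 B1 A2 B2 A3 B3 : R) : Prop := {
  coef_lim : is_lim erf p_infty L;
  coef_order : 0 < e2 < e1;
  coef_fronts : forall t, 0 <= t ->
    y1 s t = 2 * e1 * sqrt (alpha1 d * t) /\
    y2 s t = 2 * e2 * sqrt (alpha1 d * t);
  coef_profiles : forall x t, 0 < t ->
    (0 <= x <= y2 s t ->
       Phi3 s x t = similarity_profile (alpha3 d) A3 B3 x t) /\
    (y2 s t <= x <= y1 s t ->
       Phi2 s x t = similarity_profile (alpha2 d) A2 B2 x t) /\
    (y1 s t <= x ->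
       Phi1 s x t = similarity_profile (alpha1 d) A1 B1 x t);
  coef_B3 : A3 + B3 * erf (ratio3 d * e2) = TB d;
  coef_B2 : A2 + B2 * erf (ratio2 d * e2) = TB d;
  coef_C2 : A2 + B2 * erf (ratio2 d * e1) = TC d;
  coef_C1 : A1 + B1 * erf e1 = TC d;
  coef_D1 : A1 + B1 * L = TD d;
  coef_stefan2 :
    k2 d * (B2 / sqrt (PI * alpha2 d) * exp (- (ratio2 d * e2) ^ 2))
    - k3 d * (B3 / sqrt (PI * alpha3 d) * exp (- (ratio3 d * e2) ^ 2))
    = delta2 d * (e2 * sqrt (alpha1 d));
  coef_stefan1 :
    k1 d * (B1 / sqrt (PI * alpha1 d) * exp (- e1 ^ 2))
    - k2 d * (B2 / sqrt (PI * alpha2 d) * exp (- (ratio2 d * e1) ^ 2))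
    = delta1 d * (e1 * sqrt (alpha1 d));
  coef_slope0 : forall p,
    is_right_derive (fun x => Phi3 s x 1) 0 p -> p = B3 / sqrt (PI * alpha3 d);
  coef_value0 : forall t, 0 < t -> Phi3 s 0 t = A3 }.

Arguments coef_lim {d s e1 e2 L A1 B1 A2 B2 A3 B3} _.
Arguments coef_order {d s e1 e2 L A1 B1 A2 B2 A3 B3} _.
Arguments coef_B3 {d s e1 e2 L A1 B1 A2 B2 A3 B3} _.
Arguments coef_slope0 {d s e1 e2 L A1 B1 A2 B2 A3 B3} _ p _.
Arguments coef_value0 {d s e1 e2 L A1 B1 A2 B2 A3 B3} _ t _.

Lemma system_similarity_coefficients (d : data) (s : candidate) (e1 e2 : R) :
  admissible d -> system_S d s -> similarity_type d s e1 e2 ->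
  exists L A1 B1 A2 B2 A3 B3 : R,
    similarity_coefficients d s e1 e2 L A1 B1 A2 B2 A3 B3.
Proof.
intros Hd HS [He [Hy [A1 [B1 [A2 [B2 [A3 [B3 Hprof]]]]]]]].
destruct (alpha_gt0 d Hd) as [Ha1 [Ha2 Ha3]].
assert (Hs1 := sqrt_lt_R0 _ Ha1).
destruct (Hy 1 ltac:(lra)) as [Hy1 Hy2].
destruct (S_order _ _ HS 1 Rlt_0_1) as [Hy20 Hy21].
assert (Hv : forall b A B e, 0 < b ->
  similarity_profile b A B (2 * e * sqrt (alpha1 d * 1)) 1
  = A + B * erf (sqrt (alpha1 d / b) * e)).
{ intros b A B e Hb. unfold similarity_profile.
  rewrite (Rmult_1_r b), front_argument by assumption. reflexivity. }
assert (Hr1 : sqrt (alpha1 d / alpha1 d) = 1)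
  by (unfold Rdiv; rewrite Rinv_r by lra; apply sqrt_1).
destruct (S_front2 _ _ HS 1 Rlt_0_1) as [F3 F2].
destruct (S_front1 _ _ HS 1 Rlt_0_1) as [F2' F1].
rewrite (proj1 (Hprof _ _ Rlt_0_1)), Hy2, Hv in F3 by lra.
rewrite (proj1 (proj2 (Hprof _ _ Rlt_0_1))), Hy2, Hv in F2 by lra.
rewrite (proj1 (proj2 (Hprof _ _ Rlt_0_1))), Hy1, Hv in F2' by lra.
rewrite (proj2 (proj2 (Hprof _ _ Rlt_0_1))), Hy1, Hv, Hr1, Rmult_1_l in F1 by lra.
(* The condition at infinity at time [1], rescaled by [2 * sqrt (alpha1 d)]; the maximum with
   [y1 s 1] keeps the point in phase 1, where the profile is valid. *)
assert (HL : is_lim (fun x => A1 + B1 * erf x) p_infty (TD d)).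
{ apply is_lim_spec. intros eps.
  pose proof (S_infinity _ _ HS 1 Rlt_0_1) as Hinf.
  apply is_lim_spec in Hinf. destruct (Hinf eps) as [M HM].
  exists (Rmax M (y1 s 1) / (2 * sqrt (alpha1 d))). intros x Hx.
  assert (HX : Rmax M (y1 s 1) < x * (2 * sqrt (alpha1 d))).
  { apply Rmult_lt_reg_r with (/ (2 * sqrt (alpha1 d))).
    - apply Rinv_0_lt_compat; lra.
    - rewrite Rmult_assoc, Rinv_r, Rmult_1_r by lra. exact Hx. }
  pose proof (Rmax_l M (y1 s 1)). pose proof (Rmax_r M (y1 s 1)).
  specialize (HM (x * (2 * sqrt (alpha1 d))) ltac:(lra)).
  rewrite (proj2 (proj2 (Hprof _ _ Rlt_0_1))) in HM by lra.
  unfold similarity_profile in HM. rewrite Rmult_1_r in HM.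
  replace (x * (2 * sqrt (alpha1 d)) / (2 * sqrt (alpha1 d))) with x in HM
    by (field; lra).
  exact HM. }
(* Otherwise phase 1 would be constant, forcing [TC d = TD d]. Hence [HL] can be solved for the
   limit of [erf], which gives the witness [(TD d - A1) / B1] for [L]. *)
assert (HB1 : B1 <> 0).
{ intros ->.
  assert (HA : is_lim (fun x => A1 + 0 * erf x) p_infty A1).
  { apply is_lim_ext with (fun _ => A1); [intros; ring|apply is_lim_const]. }
  apply is_lim_unique in HL. apply is_lim_unique in HA.
  rewrite HL in HA. injection HA. pose proof (TD_lt_TC d Hd). lra. }
assert (D2 : forall b A B, 0 < b ->
  is_derive (fun x => similarity_profile b A B x 1) (y2 s 1)
    (B / sqrt (PI * b) * exp (- (sqrt (alpha1 d / b) * e2) ^ 2))).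
{ intros. rewrite Hy2. now apply is_derive_profile_at_front. }
assert (D1 : forall b A B, 0 < b ->
  is_derive (fun x => similarity_profile b A B x 1) (y1 s 1)
    (B / sqrt (PI * b) * exp (- (sqrt (alpha1 d / b) * e1) ^ 2))).
{ intros. rewrite Hy1. now apply is_derive_profile_at_front. }
exists ((TD d - A1) / B1), A1, B1, A2, B2, A3, B3.
constructor; try assumption.
- apply is_lim_ext with (fun x => / B1 * (A1 + B1 * erf x - A1)).
  { intros x. field. exact HB1. }
  replace (Finite ((TD d - A1) / B1)) with (Rbar_mult (/ B1) (TD d - A1))
    by (simpl; f_equal; unfold Rdiv; ring).
  apply is_lim_scal_l. apply is_lim_minus'; [exact HL|apply is_lim_const].
- field. exact HB1.
- destruct (S_stefan2 _ _ HS 1 Rlt_0_1) as [p [m [v [Hp [Hm [Hdv E]]]]]].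
  apply (right_derive_unique _ _ _ (y1 s 1) _ _ Hy21
    (fun z Hz => proj1 (proj2 (Hprof z 1 Rlt_0_1)) Hz) (D2 _ A2 B2 Ha2)) in Hp.
  apply (left_derive_unique _ _ _ 0 _ _ Hy20
    (fun z Hz => proj1 (Hprof z 1 Rlt_0_1) Hz) (D2 _ A3 B3 Ha3)) in Hm.
  apply (is_derive_front _ _ _ _ Ha1 (fun t Ht => proj2 (Hy t Ht))) in Hdv.
  rewrite Hp, Hm, Hdv in E. exact E.
- destruct (S_stefan1 _ _ HS 1 Rlt_0_1) as [p [m [v [Hp [Hm [Hdv E]]]]]].
  (* Phase 1 is unbounded, so a segment of length [1] to the right of the front will do. *)
  apply (right_derive_unique _ _ (y1 s 1) (y1 s 1 + 1) _ _ (Rlt_plus_1 _)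
    (fun z Hz => proj2 (proj2 (Hprof z 1 Rlt_0_1)) (proj1 Hz)) (D1 _ A1 B1 Ha1)) in Hp.
  apply (left_derive_unique _ _ _ (y2 s 1) _ _ Hy21
    (fun z Hz => proj1 (proj2 (Hprof z 1 Rlt_0_1)) Hz) (D1 _ A2 B2 Ha2)) in Hm.
  apply (is_derive_front _ _ _ _ Ha1 (fun t Ht => proj1 (Hy t Ht))) in Hdv.
  rewrite Hr1, Rmult_1_l in Hp. rewrite Hp, Hm, Hdv in E. exact E.
- intros p Hp.
  rewrite (right_derive_unique _ _ _ (y2 s 1) _ _ Hy20
    (fun z Hz => proj1 (Hprof z 1 Rlt_0_1) Hz)
    (is_derive_similarity_profile _ _ _ _ Ha3) Hp).
  replace (- (0 / (2 * sqrt (alpha3 d))) ^ 2) with 0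
    by (unfold Rdiv; ring).
  rewrite exp_0. ring.
- intros t Ht. destruct (S_order _ _ HS t Ht).
  rewrite (proj1 (Hprof 0 t Ht)) by lra.
  unfold similarity_profile. replace (0 / (2 * sqrt (alpha3 d * t))) with 0
    by (unfold Rdiv; ring).
  rewrite erf_0. ring.
Qed.

(** Here [alpha3 d < alpha2 d] is turned into the hypothesis [r2 < r3] of [fronts_unique]. *)
Lemma ratio_order (d : data) : admissible d -> 0 < ratio2 d < ratio3 d.
Proof.
intros Hd. destruct (alpha_gt0 d Hd) as [Ha1 [Ha2 Ha3]].
pose proof (alpha3_lt_alpha2 d Hd).
split; [apply sqrt_lt_R0, Rdiv_lt_0_compat; assumption|].
apply sqrt_lt_1_alt. split.
- apply Rlt_le, Rdiv_lt_0_compat; assumption.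
- apply Rmult_lt_compat_l; [exact Ha1|].
  apply Rinv_lt_contravar; [apply Rmult_lt_0_compat|]; assumption.
Qed.

(** * The front equations and the uniqueness of the solution *)

(** The two temperatures prescribed for phase 2 give [B2], those for phase 1 (at the front and at
    infinity) give [B1], and the flux [q] at [x = 0] replaces [B3]. Inserted into the Stefan
    conditions, these yield the equations in the shape required by [fronts_unique]. *)
Lemma coefficients_balance (d : data) (s : candidate)
    (e1 e2 L A1 B1 A2 B2 A3 B3 q : R) :
  admissible d ->
  similarity_coefficients d s e1 e2 L A1 B1 A2 B2 A3 B3 ->
  k3 d * (B3 / sqrt (PI * alpha3 d)) = - q ->
  let K := k2 d * (TB d - TC d) / sqrt (PI * alpha2 d) in
  let De := erf (ratio2 d * e1) - erf (ratio2 d * e2) in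
  delta1 d * sqrt (alpha1 d) * e1
    + k1 d * (TC d - TD d) / sqrt (PI * alpha1 d) * (exp (- e1 ^ 2) / (L - erf e1))
    = K / De * exp (- (ratio2 d * e1) ^ 2) /\
  q * exp (- (ratio3 d * e2) ^ 2) - delta2 d * sqrt (alpha1 d) * e2
    = K / De * exp (- (ratio2 d * e2) ^ 2).
Proof.
intros Hd HC Hq K De.
pose proof (coef_order HC) as He.
pose proof (ratio_order d Hd) as Hr.
assert (HDe : erf (ratio2 d * e2) < erf (ratio2 d * e1)) by (apply erf_increasing; nra).
pose proof (erf_lt_lim L e1 (coef_lim HC)) as HLe.
destruct (alpha_gt0 d Hd) as [Ha1 [Ha2 Ha3]].
assert (HP1 : 0 < sqrt (PI * alpha1 d))
  by (apply sqrt_lt_R0, Rmult_lt_0_compat; [apply PI_RGT_0|assumption]).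
assert (HP2 : 0 < sqrt (PI * alpha2 d))
  by (apply sqrt_lt_R0, Rmult_lt_0_compat; [apply PI_RGT_0|assumption]).
destruct HC as [_ _ _ _ _ H2B H2C H1C H1D S2 S1 _ _].
assert (HB2 : B2 = - (TB d - TC d) / De).
{ unfold De. rewrite <- H2B, <- H2C. field. lra. }
assert (HB1 : B1 = - (TC d - TD d) / (L - erf e1)).
{ rewrite <- H1C, <- H1D. field. lra. }
replace (k3 d * (B3 / sqrt (PI * alpha3 d) * exp (- (ratio3 d * e2) ^ 2)))
  with (k3 d * (B3 / sqrt (PI * alpha3 d)) * exp (- (ratio3 d * e2) ^ 2)) in S2 by ring.
rewrite Hq, HB2 in S2. rewrite HB1, HB2 in S1.
split.
- replace (delta1 d * sqrt (alpha1 d) * e1)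
    with (delta1 d * (e1 * sqrt (alpha1 d))) by ring.
  rewrite <- S1. unfold K, De. field. lra.
- replace (delta2 d * sqrt (alpha1 d) * e2)
    with (delta2 d * (e2 * sqrt (alpha1 d))) by ring.
  rewrite <- S2. unfold K, De. field. lra.
Qed.

(** The function [q] lets one statement serve both problems: it is constant for a prescribed flux
    and equals [equivalent_flux] for the convective condition. *)
Lemma similarity_coefficients_coincide (d : data) (q : R -> R) (s s' : candidate)
    (e1 e2 L A1 B1 A2 B2 A3 B3 e1' e2' L' A1' B1' A2' B2' A3' B3' : R) :
  admissible d ->
  (forall x y, 0 < x -> x <= y -> 0 < q y <= q x) ->
  similarity_coefficients d s e1 e2 L A1 B1 A2 B2 A3 B3 ->
  k3 d * (B3 / sqrt (PI * alpha3 d)) = - q e2 ->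
  similarity_coefficients d s' e1' e2' L' A1' B1' A2' B2' A3' B3' ->
  k3 d * (B3' / sqrt (PI * alpha3 d)) = - q e2' ->
  coincide s s'.
Proof.
intros Hd Hq HC HB HC' HB'.
assert (HLL : L' = L).
{ pose proof (is_lim_unique _ _ _ (coef_lim HC)) as H.
  rewrite (is_lim_unique _ _ _ (coef_lim HC')) in H.
  now injection H. }
subst L'.
pose proof (ratio_order d Hd) as Hr.
destruct (alpha_gt0 d Hd) as [Ha1 [Ha2 Ha3]].
assert (HP : forall a, 0 < a -> 0 < sqrt (PI * a))
  by (intros a Ha; apply sqrt_lt_R0, Rmult_lt_0_compat; [apply PI_RGT_0|assumption]).
destruct (coefficients_balance _ _ _ _ _ _ _ _ _ _ _ _ Hd HC HB) as [E1 E2].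
destruct (coefficients_balance _ _ _ _ _ _ _ _ _ _ _ _ Hd HC' HB') as [E1' E2'].
destruct HC as [HL He Hy Hp H3B H2B H2C H1C H1D _ _ _ _].
destruct HC' as [_ He' Hy' Hp' H3B' H2B' H2C' H1C' H1D' _ _ _ _].
assert (HE : e1 = e1' /\ e2 = e2').
{ pose proof (TD_lt_TC d Hd). pose proof (TC_lt_TB d Hd).
  eapply fronts_unique with (10 := E1) (11 := E2) (12 := E1') (13 := E2');
    try assumption; destruct Hd; unfold delta1, delta2;
    repeat first [apply Rdiv_lt_0_compat | apply Rmult_lt_0_compat
                 | apply HP | apply sqrt_lt_R0]; lra. }
destruct HE as [<- <-].
assert (HDe : erf (ratio2 d * e2) < erf (ratio2 d * e1)) by (apply erf_increasing; nra).
pose proof (erf_lt_lim L e1 HL) as HLe.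
(* With the fronts identified the rest is linear: [B3] follows from the common flux, [B2] and [B1]
   from temperature differences, and the [A] coefficients from the front temperatures. *)
assert (HB3 : B3 = B3').
{ pose proof (HP _ Ha3). pose proof (k3_gt0 d Hd). rewrite <- HB' in HB.
  apply Rmult_eq_reg_l in HB; [|lra].
  apply Rmult_eq_reg_r in HB; [exact HB|]. apply Rinv_neq_0_compat; lra. }
assert (HB2 : B2 = B2').
{ apply Rmult_eq_reg_r with (erf (ratio2 d * e1) - erf (ratio2 d * e2)); lra. }
assert (HB1 : B1 = B1') by (apply Rmult_eq_reg_r with (L - erf e1); lra).
subst B1' B2' B3'.
assert (A1 = A1') by lra. assert (A2 = A2') by lra. assert (A3 = A3') by lra.
subst A1' A2' A3'.
assert (HY : forall t, 0 <= t -> y1 s t = y1 s' t /\ y2 s t = y2 s' t).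
{ intros t Ht. destruct (Hy t Ht) as [-> ->]. destruct (Hy' t Ht) as [-> ->].
  now split. }
split; [exact HY|].
intros x t Ht. specialize (Hp x t Ht). specialize (Hp' x t Ht).
destruct (HY t ltac:(lra)) as [Y1 Y2]. rewrite <- Y1, <- Y2 in Hp'.
destruct Hp as [P3 [P2 P1]]. destruct Hp' as [P3' [P2' P1']].
repeat split; intros Hx.
- rewrite P3, P3'; trivial.
- rewrite P2, P2'; trivial.
- rewrite P1, P1'; trivial.
Qed.

Lemma coincide_refl (s : candidate) : coincide s s.
Proof. repeat split. Qed.

(** * The flux at [x = 0] in the two problems *)

Lemma P3_flux_coefficient (d : data) (q0 : R) (s : candidate)
    (e1 e2 L A1 B1 A2 B2 A3 B3 : R) :
  problem_P3 d q0 s ->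
  similarity_coefficients d s e1 e2 L A1 B1 A2 B2 A3 B3 ->
  k3 d * (B3 / sqrt (PI * alpha3 d)) = - q0.
Proof.
intros [_ [_ Hflux]] HC.
destruct (Hflux 1 Rlt_0_1) as [p [Hp E]].
rewrite (coef_slope0 HC p Hp), sqrt_1 in E.
rewrite E. field.
Qed.

(** This keeps the denominator of [equivalent_flux] above [1]. *)
Lemma transfer_erf_term_gt0 (d : data) (h0 e : R) :
  admissible d -> 0 < h0 -> 0 < e ->
  0 < h0 * sqrt (PI * alpha3 d) / k3 d * erf (e * sqrt (alpha1 d / alpha3 d)).
Proof.
intros Hd Hh He. destruct (alpha_gt0 d Hd) as [Ha1 [Ha2 Ha3]].
apply Rmult_lt_0_compat.
- apply Rdiv_lt_0_compat; [|apply k3_gt0, Hd].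
  apply Rmult_lt_0_compat; [exact Hh|].
  apply sqrt_lt_R0, Rmult_lt_0_compat; [apply PI_RGT_0|assumption].
- apply erf_gt0, Rmult_lt_0_compat; [exact He|].
  apply sqrt_lt_R0, Rdiv_lt_0_compat; assumption.
Qed.

(** A larger front coefficient enlarges the denominator. This is the hypothesis on [q] under which
    convective solutions are unique. *)
Lemma equivalent_flux_decreasing (d : data) (h0 Ainf x y : R) :
  admissible d -> 0 < h0 -> TB d < Ainf -> 0 < x -> x <= y ->
  0 < equivalent_flux d h0 Ainf y <= equivalent_flux d h0 Ainf x.
Proof.
intros Hd Hh HA Hx Hxy.
pose proof (transfer_erf_term_gt0 d h0 x Hd Hh Hx) as Dx.
pose proof (transfer_erf_term_gt0 d h0 y Hd Hh ltac:(lra)) as Dy.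
assert (HN : 0 < (Ainf - TB d) * h0) by (apply Rmult_lt_0_compat; lra).
unfold equivalent_flux. split; [apply Rdiv_lt_0_compat; lra|].
destruct Hxy as [Hxy|<-]; [|apply Rle_refl].
apply Rmult_le_compat_l; [lra|]. apply Rinv_le_contravar; [lra|].
apply Rplus_le_compat_l, Rmult_le_compat_l.
- apply Rlt_le, Rdiv_lt_0_compat; [|apply k3_gt0, Hd].
  destruct (alpha_gt0 d Hd) as [Ha1 [Ha2 Ha3]].
  apply Rmult_lt_0_compat; [exact Hh|].
  apply sqrt_lt_R0, Rmult_lt_0_compat; [apply PI_RGT_0|assumption].
- apply Rlt_le, erf_increasing, Rmult_lt_compat_r; [|exact Hxy].
  apply sqrt_lt_R0, Rdiv_lt_0_compat; apply alpha_gt0, Hd.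
Qed.

(** The convective condition and the temperature [TB d] on the second front are two linear equations
    for [A3] and [B3]; solving them produces [equivalent_flux]. The second conclusion serves to
    rewrite the boundary condition at every time. *)
Lemma P1_flux_coefficient (d : data) (h0 Ainf : R) (s : candidate)
    (e1 e2 L A1 B1 A2 B2 A3 B3 : R) :
  admissible d -> problem_P1 d h0 Ainf s ->
  similarity_coefficients d s e1 e2 L A1 B1 A2 B2 A3 B3 ->
  k3 d * (B3 / sqrt (PI * alpha3 d)) = - equivalent_flux d h0 Ainf e2 /\
  h0 * (A3 - Ainf) = - equivalent_flux d h0 Ainf e2.
Proof.
intros Hd [Hh [HA [_ Hflux]]] HC.
destruct (Hflux 1 Rlt_0_1) as [p [Hp E]].
rewrite (coef_slope0 HC p Hp),
  (coef_value0 HC 1 Rlt_0_1), sqrt_1, Rdiv_1_r in E.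
rewrite E.
assert (H : h0 * (A3 - Ainf) = - equivalent_flux d h0 Ainf e2); [|now split].
pose proof (coef_B3 HC) as H3B.
pose proof (transfer_erf_term_gt0 d h0 e2 Hd Hh
  (proj1 (coef_order HC))) as HD.
pose proof (k3_gt0 d Hd) as Hk.
assert (HP : 0 < sqrt (PI * alpha3 d)).
{ apply sqrt_lt_R0, Rmult_lt_0_compat; [apply PI_RGT_0|apply alpha_gt0, Hd]. }
unfold equivalent_flux. fold (ratio3 d) in *. rewrite (Rmult_comm e2) in *.
set (X := erf (ratio3 d * e2)) in *.
assert (HB : B3 = h0 * (A3 - Ainf) * sqrt (PI * alpha3 d) / k3 d).
{ rewrite <- E. field. lra. }
apply Rmult_eq_reg_r with (1 + h0 * sqrt (PI * alpha3 d) / k3 d * X); [|lra].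
transitivity (- ((Ainf - TB d) * h0)); [|field].
- rewrite <- H3B, HB at 1. field. lra.
(* Side condition of [field]: the denominator multiplied by [k3 d] is nonzero. *)
- split; [lra|]. intros H0. apply (Rlt_irrefl 0).
  rewrite <- H0 at 2.
  replace (k3 d + h0 * sqrt (PI * alpha3 d) * X)
    with (k3 d * (1 + h0 * sqrt (PI * alpha3 d) / k3 d * X)) by (field; lra).
  apply Rmult_lt_0_compat; lra.
Qed.

Theorem theorem3p13 (d : data) (hd : admissible d)
    (z0 : R) (z0_gt0 : 0 < z0) (z0_zero : Hfun d z0 = 0) :
  (forall (Ainf h0 : R), TB d < Ainf -> h2 d Ainf z0 < h0 ->
   forall (v : candidate) (xi1 xi2 : R),
     similarity_solution d (problem_P1 d h0 Ainf) v xi1 xi2 ->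
     q2 d z0 < equivalent_flux d h0 Ainf xi2 ->
     exists theta : candidate,
       the_similarity_solution d
         (problem_P3 d (equivalent_flux d h0 Ainf xi2)) theta /\
       coincide theta v)
  /\
  (forall (q0 Ainf : R), q2 d z0 < q0 -> TB d < Ainf ->
   forall (theta : candidate) (lambda1 lambda2 : R),
     similarity_solution d (problem_P3 d q0) theta lambda1 lambda2 ->
     equivalent_transfer_denominator d q0 Ainf lambda2 <> 0 ->
     h2 d Ainf z0 < equivalent_transfer d q0 Ainf lambda2 ->
     exists v : candidate,
       the_similarity_solution d
         (problem_P1 d (equivalent_transfer d q0 Ainf lambda2) Ainf) v /\
       coincide v theta).
Proof.
split.
- intros Ainf h0 HA _ v xi1 xi2 [HP1 Hsim] _.
  pose proof HP1 as [Hh [_ [HS Hflux]]].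
  destruct (system_similarity_coefficients d v xi1 xi2 hd HS Hsim)
    as [L [A1 [B1 [A2 [B2 [A3 [B3 HC]]]]]]].
  destruct (P1_flux_coefficient _ _ _ _ _ _ _ _ _ _ _ _ _ hd HP1 HC) as [HB HA3].
  destruct (equivalent_flux_decreasing d h0 Ainf xi2 xi2 hd Hh HA
    (proj1 (coef_order HC)) (Rle_refl _)) as [Hq _].
  (* The temperature at [x = 0] is the constant [A3], so the convective flux of [v] is
     [h0 * (A3 - Ainf) / sqrt t], exactly the flux prescribed in the other problem. *)
  exists v. split; [|apply coincide_refl]. split.
  + exists xi1, xi2. split; [|exact Hsim].
    split; [exact Hq|split; [exact HS|]].
    intros t Ht. destruct (Hflux t Ht) as [p [Hp E]]. exists p. split; [exact Hp|].
    rewrite E, (coef_value0 HC t Ht).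
    replace (h0 / sqrt t * (A3 - Ainf)) with (h0 * (A3 - Ainf) / sqrt t)
      by (unfold Rdiv; ring).
    rewrite HA3. unfold Rdiv. ring.
  + intros s e1 e2 [HP3 Hs].
    destruct (system_similarity_coefficients d s e1 e2 hd (proj1 (proj2 HP3)) Hs)
      as [L' [A1' [B1' [A2' [B2' [A3' [B3' HC']]]]]]].
    (* The flux is now a fixed number, the same for every competitor [s], so [q] is constant. *)
    eapply (similarity_coefficients_coincide d
      (fun _ => equivalent_flux d h0 Ainf xi2) s v) with (3 := HC') (5 := HC);
      [exact hd | intros; lra | | exact HB].
    exact (P3_flux_coefficient _ _ _ _ _ _ _ _ _ _ _ _ HP3 HC').
- intros q0 Ainf _ HA theta l1 l2 [HP3 Hsim] Hden Hh2.
  pose proof HP3 as [Hq [HS Hflux]].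
  set (h0 := equivalent_transfer d q0 Ainf l2) in *.
  destruct (system_similarity_coefficients d theta l1 l2 hd HS Hsim)
    as [L [A1 [B1 [A2 [B2 [A3 [B3 HC]]]]]]].
  pose proof (P3_flux_coefficient _ _ _ _ _ _ _ _ _ _ _ _ HP3 HC) as HB.
  destruct (alpha_gt0 d hd) as [Ha1 [Ha2 Ha3]].
  assert (HP : 0 < sqrt (PI * alpha3 d)).
  { apply sqrt_lt_R0, Rmult_lt_0_compat; [apply PI_RGT_0|assumption]. }
  pose proof (k3_gt0 d hd) as Hk.
  (* Positivity comes from [h2 d Ainf z0 < h0], because [h2] is a product of nonnegative factors. *)
  assert (Hh : 0 < h0).
  { apply Rle_lt_trans with (2 := Hh2). unfold h2.
    apply Rmult_le_pos; [apply Rmult_le_pos; [|apply sqrt_pos]|].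
    - apply Rlt_le, Rdiv_lt_0_compat; [pose proof (TC_lt_TB d hd)|]; lra.
    - apply Rlt_le, Rdiv_lt_0_compat; [lra|].
      apply erf_gt0, Rmult_lt_0_compat; [exact z0_gt0|].
      apply sqrt_lt_R0, Rdiv_lt_0_compat; assumption. }
  assert (HA3 : h0 * (A3 - Ainf) = - q0).
  (* The denominator is the gap between [Ainf] and the temperature [A3] at [x = 0]: subtract
     [B3 * erf (ratio3 d * l2)] from [TB d] and express [B3] by the flux [q0]. *)
  { assert (HA3 : A3 - Ainf = - equivalent_transfer_denominator d q0 Ainf l2).
    { unfold equivalent_transfer_denominator. fold (ratio3 d).
      rewrite <- (coef_B3 HC), (Rmult_comm l2).
      replace q0 with (- (k3 d * (B3 / sqrt (PI * alpha3 d)))) by (rewrite HB; ring).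
      field. lra. }
    rewrite HA3. unfold h0, equivalent_transfer. field. exact Hden. }
  assert (HP1 : problem_P1 d h0 Ainf theta).
  { split; [exact Hh|split; [exact HA|split; [exact HS|]]].
    intros t Ht. destruct (Hflux t Ht) as [p [Hp E]]. exists p. split; [exact Hp|].
    rewrite E, (coef_value0 HC t Ht).
    replace (h0 / sqrt t * (A3 - Ainf)) with (h0 * (A3 - Ainf) / sqrt t)
      by (unfold Rdiv; ring).
    rewrite HA3. unfold Rdiv. ring. }
  exists theta. split; [|apply coincide_refl]. split.
  + exists l1, l2. now split.
  + intros s e1 e2 [HPs Hs].
    destruct (system_similarity_coefficients d s e1 e2 hd
      (proj1 (proj2 (proj2 HPs))) Hs)
      as [L' [A1' [B1' [A2' [B2' [A3' [B3' HC']]]]]]].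
    (* The flux of a competitor depends on its own second coefficient, hence the nonconstant [q];
       [theta] fits the same [q] because it solves the convective problem by [HP1]. *)
    eapply (similarity_coefficients_coincide d
      (fun e => equivalent_flux d h0 Ainf e) s theta) with (3 := HC') (5 := HC);
      [exact hd | | |].
    * intros x y Hx Hxy. now apply equivalent_flux_decreasing.
    * exact (proj1 (P1_flux_coefficient _ _ _ _ _ _ _ _ _ _ _ _ _ hd HPs HC')).
    * exact (proj1 (P1_flux_coefficient _ _ _ _ _ _ _ _ _ _ _ _ _ hd HP1 HC)).
Qed.
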